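(* Let $(H,\mu)$ be a finite-dimensional commutative Hilbertian Frobenius semigroup. The following assertions are equivalent: (1) $(H,\mu)$ has a unit; (2) $\mu$ is onto; (3) $\mu^{\dagger}$ is one-to-one; (4) $(H,\mu)$ is semisimple.
   Context: All Hilbert spaces are complex; $\hat{\otimes}_2$ is the Hilbert space tensor product (the algebraic tensor product with its canonical inner product in finite dimension); $f^{\dagger}$ is the Hilbert adjoint. A Hilbertian semigroup is a pair $(H,\mu)$ with $H$ a Hilbert space and $\mu\colon H\hat{\otimes}_2H\to H$ bounded linear, associative and commutative; write $xy:=\mu(x\otimes y)$. It is finite-dimensional when $H$ is. With $\alpha\colon (H\hat{\otimes}_2H)\hat{\otimes}_2H\to H\hat{\otimes}_2(H\hat{\otimes}_2H)$ the canonical unitary, it is a Hilbertian Frobenius semigroup when $(\mu\hat{\otimes}_2 id)\circ\alpha^{-1}\circ(id\hat{\otimes}_2\mu^{\dagger})=\mu^{\dagger}\circ\mu=(id\hat{\otimes}_2\mu)\circ\alpha\circ(\mu^{\dagger}\hat{\otimes}_2 id)$. A unit is an element $e\in H$ with $eu=u$ for all $u\in H$ (the zero algebra is unital). $(H,\mu)$ is semisimple when its Jacobson radical (the intersection of the maximal modular ideals, equivalently of the kernels of the non-zero algebra maps $H\to\mathbb{C}$; equal to $H$ if there are none) is $(0)$. *)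

(* Defs.v *)
From HB Require Import structures.
From mathcomp Require Import all_boot all_order all_algebra.

Set Implicit Arguments.
Unset Strict Implicit.
Unset Printing Implicit Defensive.

Import Order.TTheory GRing.Theory Num.Theory Num.Def.
Local Open Scope ring_scope.

(* For C := R[i] with R : realType, a finite-dimensional complex Hilbert space
   is a vectType over C together with an inner product {dot U for conjC}: linear
   in its first argument and conjugate-linear in the second one.  Completeness,
   and the boundedness of linear maps, are automatic. *)

Section Basis.
Variables (C : fieldType) (U : vectType C).

Definition bas (i : 'I_(\dim {:U})) : U := (vbasis {:U})`_i.

Lemma basE (u : U) : u = \sum_i coord (vbasis {:U}) i u *: bas i.
Proof. exact: coord_vbasis (memvf u). Qed.

Lemma coord_bas i j : coord (vbasis {:U}) i (bas j) = (i == j)%:R.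
Proof. by rewrite /bas coord_free ?(basis_free (vbasisP _)) // eq_sym. Qed.

End Basis.

Section Tensor.
Variable C : fieldType.
Implicit Types U V W T : vectType C.

(* The algebraic tensor product, in coordinates: the (i, j) entry of a tensor
   is its coefficient on bas i (x) bas j.  That this is a tensor product is
   shown by pure_is_bilinear, tensor_liftE and tensor_ext below. *)
Definition tensor U V : vectType C := 'M[C]_(\dim {:U}, \dim {:V}).

Definition pure U V (u : U) (v : V) : tensor U V :=
  \matrix_(i, j) (coord (vbasis {:U}) i u * coord (vbasis {:V}) j v).

Fact pure_is_bilinear U V : bilinear_for *:%R *:%R (@pure U V).
Proof.
split=> x a u v; apply/matrixP=> i j; rewrite !mxE linearP /=.
  by rewrite mulrDl mulrA.
by rewrite mulrDr mulrCA.
Qed.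
HB.instance Definition _ U V :=
  bilinear_isBilinear.Build C U V (tensor U V) *:%R *:%R (@pure U V)
    (@pure_is_bilinear U V).

Lemma tensorE U V (A : tensor U V) :
  A = \sum_i \sum_j A i j *: pure (bas i) (bas j).
Proof.
apply/matrixP=> k l; rewrite summxE (bigD1 k) //= summxE (bigD1 l) //=.
rewrite !mxE !coord_bas !eqxx !mulr1 big1 ?addr0 => [|j jl]; last first.
  by rewrite !mxE !coord_bas [l == j]eq_sym (negPf jl) !mulr0.
rewrite big1 ?addr0 // => i ik; rewrite summxE big1 // => j _.
by rewrite !mxE !coord_bas [k == i]eq_sym (negPf ik) mul0r mulr0.
Qed.

(* The linear map induced on U (x) V by a bilinear map b. *)
Definition tensor_lift U V W (b : U -> V -> W) : 'Hom(tensor U V, W) :=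
  linfun (fun A : tensor U V => \sum_i \sum_j A i j *: b (bas i) (bas j)).

Fact tensor_lift_linear U V W (b : U -> V -> W) :
  linear (fun A : tensor U V => \sum_i \sum_j A i j *: b (bas i) (bas j)).
Proof.
move=> a A B; rewrite scaler_sumr -big_split; apply: eq_bigr => i _ /=.
rewrite scaler_sumr -big_split; apply: eq_bigr => j _ /=.
by rewrite !mxE scalerDl scalerA.
Qed.

Lemma tensor_liftE U V W (b : U -> V -> W) :
  bilinear_for *:%R *:%R b -> forall u v, tensor_lift b (pure u v) = b u v.
Proof.
move=> bb u v; pose L := GRing.isLinear.Build _ _ _ _ _ (tensor_lift_linear b).
pose f : {linear tensor U V -> W} := HB.pack
  (fun A : tensor U V => \sum_i \sum_j A i j *: b (bas i) (bas j)) L.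
rewrite /tensor_lift (lfunE f) /= -/f.
pose bL : {bilinear U -> V -> W} :=
  HB.pack b (bilinear_isBilinear.Build C U V W *:%R *:%R b bb).
rewrite -[b]/(bL : U -> V -> W) [in RHS](basE u) [in RHS](basE v).
rewrite linear_sumlz; apply: eq_bigr => i _.
rewrite linear_sumr; apply: eq_bigr => j _.
by rewrite linearZlr /= mxE scalerA.
Qed.

Lemma tensor_ind U V (P : tensor U V -> Prop) :
  P 0 -> (forall A B, P A -> P B -> P (A + B)) ->
  (forall u v, P (pure u v)) -> forall A, P A.
Proof.
move=> P0 PD Pp A; rewrite (tensorE A).
by do 2![apply: big_ind => // ? _]; rewrite -linearZl_LR; apply: Pp.
Qed.

Lemma tensor_ext U V W (f g : 'Hom(tensor U V, W)) :
  (forall u v, f (pure u v) = g (pure u v)) -> f = g.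
Proof.
move=> fg; apply/lfunP=> A; rewrite (tensorE A) !linear_sum.
apply: eq_bigr => i _; rewrite !linear_sum; apply: eq_bigr => j _.
by rewrite !linearZ /= fg.
Qed.

Definition tensor_map U V U' V' (f : 'Hom(U, U')) (g : 'Hom(V, V')) :
    'Hom(tensor U V, tensor U' V') :=
  tensor_lift (fun u v => pure (f u) (g v)).

Lemma tensor_mapE U V U' V' (f : 'Hom(U, U')) (g : 'Hom(V, V')) u v :
  tensor_map f g (pure u v) = pure (f u) (g v).
Proof.
rewrite tensor_liftE //; split=> x a y z /=; rewrite linearP.
  by rewrite (pure_is_bilinear _ _).1.
by rewrite (pure_is_bilinear _ _).2.
Qed.

Definition tensor_assoc U V W :
    'Hom(tensor (tensor U V) W, tensor U (tensor V W)) :=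
  tensor_lift (fun t w => tensor_lift (fun u v => pure u (pure v w)) t).

Lemma tensor_assocE U V W u v w :
  tensor_assoc U V W (pure (pure u v) w) = pure u (pure v w).
Proof.
have P X Y := pure_is_bilinear X Y.
have b1 (z : W) : bilinear_for *:%R *:%R
    (fun (x : U) (y : V) => pure x (pure y z)).
  by split=> x a y t /=; rewrite ?(P _ _).1 ?(P _ _).2.
rewrite tensor_liftE ?tensor_liftE //; split=> [z|t] a x y /=.
  by rewrite linearP.
rewrite (tensorE t) !linear_sum -big_split; apply: eq_bigr => i _ /=.
rewrite !linear_sum -big_split; apply: eq_bigr => j _ /=.
by rewrite !linearZ /= !tensor_liftE // !(P _ _).2 scalerDr !scalerA.
Qed.

Let associ U V W : 'Hom(tensor U (tensor V W), tensor (tensor U V) W) :=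
  tensor_lift (fun u t => tensor_lift (fun v w => pure (pure u v) w) t).

Let associE U V W u v w :
  associ U V W (pure u (pure v w)) = pure (pure u v) w.
Proof.
have P X Y := pure_is_bilinear X Y.
have b1 (x : U) : bilinear_for *:%R *:%R
    (fun (y : V) (z : W) => pure (pure x y) z).
  by split=> z a y t /=; rewrite ?(P _ _).2 ?(P _ _).1.
rewrite tensor_liftE ?tensor_liftE //; split=> [t|x] a y z /=; last first.
  by rewrite linearP.
rewrite (tensorE t) !linear_sum -big_split; apply: eq_bigr => i _ /=.
rewrite !linear_sum -big_split; apply: eq_bigr => j _ /=.
by rewrite !linearZ /= !tensor_liftE // !(P _ _).1 scalerDr !scalerA.
Qed.

Lemma tensor_assoc_bij U V W : bijective (tensor_assoc U V W).
Proof.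
exists (associ U V W).
  suff: (associ U V W \o tensor_assoc U V W)%VF = \1%VF.
    by move=> E x; rewrite -comp_lfunE E id_lfunE.
  apply: tensor_ext => t w; rewrite comp_lfunE id_lfunE (tensorE t).
  rewrite linear_sumlz !linear_sum; apply: eq_bigr => i _ /=.
  rewrite linear_sumlz !linear_sum; apply: eq_bigr => j _ /=.
  by rewrite linearZl_LR !linearZ /= tensor_assocE associE.
suff: (tensor_assoc U V W \o associ U V W)%VF = \1%VF.
  by move=> E x; rewrite -comp_lfunE E id_lfunE.
apply: tensor_ext => u t; rewrite comp_lfunE id_lfunE (tensorE t).
rewrite linear_sumr !linear_sum; apply: eq_bigr => i _ /=.
rewrite linear_sumr !linear_sum; apply: eq_bigr => j _ /=.
by rewrite linearZr_LR !linearZ /= associE tensor_assocE.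
Qed.

Lemma tensor_assoc_invE U V W u v w :
  ((tensor_assoc U V W)^-1)%VF (pure u (pure v w)) = pure (pure u v) w.
Proof.
apply: (bij_inj (@tensor_assoc_bij U V W)).
by rewrite limg_lfunVK ?tensor_assocE // -tensor_assocE memv_img ?memvf.
Qed.

End Tensor.

Section Hilbert.
Variable C : numClosedFieldType.
Implicit Types U V : vectType C.

Section OrthonormalBasis.
Variables (U : vectType C) (p : {dot U for conjC}).

Fact onb_exists : exists e : (\dim {:U}).-tuple U, orthonormal p e.
Proof.
suff H k : (k <= \dim {:U})%N -> exists e : k.-tuple U, orthonormal p e.
  exact: (H _ (leqnn _)).
elim: k => [_|k IHk ltk]; first by exists [tuple].
have [e oe] := IHk (ltnW ltk).
have /subvPn[x _ xNe] : ~~ (fullv <= <<e>>)%VS.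
  apply/negP=> /dimvS/(leq_trans ltk)/leq_trans/(_ (dim_span e)).
  by rewrite size_tuple ltnn.
have [a ae [b [xab _ ob]]] := orthogonal_split p e x.
have b0 : b != 0.
  by apply: contra xNe => /eqP b0; rewrite xab b0 addr0.
pose c := (sqrtC (p b b))^-1.
have pb : 0 < p b b by rewrite dnorm_gt0.
exists [tuple of (c *: b) :: e]; change (orthonormal p ((c *: b) :: e)).
rewrite -cat1s orthonormal_cat oe; apply/and3P; split=> //.
  rewrite /orthonormal /= !andbT dnormZ /c normfV ger0_norm ?sqrtC_ge0 ?ltW //.
  by rewrite exprVn sqrtCK mulVf ?eqxx // gt_eqF.
apply/orthoPl=> y ye; by rewrite linearZl_LR /= (orthoPl ob) ?mulr0.
Qed.

Definition onb : (\dim {:U}).-tuple U := xchoose onb_exists.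

Lemma onb_orthonormal : orthonormal p onb.
Proof. exact: xchooseP onb_exists. Qed.

Lemma onbP (i j : 'I_(\dim {:U})) : p onb`_i onb`_j = (i == j)%:R.
Proof.
have [u E] := orthonormalP onb_orthonormal.
by rewrite E ?mem_nth ?size_tuple // nth_uniq ?size_tuple.
Qed.

Lemma onbE u : u = \sum_(i < \dim {:U}) p u onb`_i *: onb`_i.
Proof.
have fe : free onb by apply: orthonormal_free onb_orthonormal.
have be : basis_of fullv onb.
  by rewrite basisEfree fe subvf size_tuple leqnn.
rewrite {1}(coord_basis be (memvf u)); apply: eq_bigr => i _; congr (_ *: _).
rewrite [in RHS](coord_basis be (memvf u)) linear_sumlz (bigD1 i) //=.
rewrite linearZl_LR /= onbP eqxx mulr1 big1 ?addr0 // => j ji.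
by rewrite linearZl_LR /= onbP (negPf ji) mulr0.
Qed.

Lemma parseval u v : p u v = \sum_(i < \dim {:U}) p u onb`_i * (p v onb`_i)^*.
Proof.
rewrite [in LHS](onbE v) linear_sumr; apply: eq_bigr => i _.
by rewrite linearZr_LR /= mulrC.
Qed.

Lemma onb_eq0 u : (forall i : 'I_(\dim {:U}), p u onb`_i = 0) -> u = 0.
Proof. by move=> h; rewrite (onbE u) big1 // => i _; rewrite h scale0r. Qed.

End OrthonormalBasis.

Section TensorDot.
Variables (U V : vectType C) (p : {dot U for conjC}) (q : {dot V for conjC}).

(* The sesquilinear extension of <u (x) v, u' (x) v'> = <u, u'> <v, v'>; see
   tensor_dotE. *)
Definition tensor_dot (A B : tensor U V) : C :=
  \sum_i \sum_j \sum_k \sum_l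
    A i j * (B k l)^* * (p (bas i) (bas k) * q (bas j) (bas l)).

Fact tensor_dot_bilinear :
  bilinear_for *%R (conjC \; *%R) tensor_dot.
Proof.
split=> X a A B; rewrite /tensor_dot /= mulr_sumr -big_split; apply: eq_bigr => i _ /=;
  rewrite mulr_sumr -big_split; apply: eq_bigr => j _ /=;
  rewrite mulr_sumr -big_split; apply: eq_bigr => k _ /=;
  rewrite mulr_sumr -big_split; apply: eq_bigr => l _ /=; rewrite !mxE.
  by rewrite !mulrDl !mulrA.
by rewrite rmorphD rmorphM /= mulrDr mulrDl !mulrA [a^* * _]mulrC.
Qed.
HB.instance Definition _ := bilinear_isBilinear.Build C (tensor U V)
  (tensor U V) C *%R (conjC \; *%R) tensor_dot tensor_dot_bilinear.


Let X (A : tensor U V) (z : 'I_(\dim {:U}) * 'I_(\dim {:V})) : C :=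
  \sum_i \sum_j A i j * (p (bas i) (onb p)`_z.1 * q (bas j) (onb q)`_z.2).

Let tensor_dotX A B : tensor_dot A B = \sum_z X A z * (X B z)^*.
Proof.
pose P (x z : 'I_(\dim {:U}) * 'I_(\dim {:V})) :=
  p (bas x.1) (onb p)`_z.1 * q (bas x.2) (onb q)`_z.2.
have XE D z : X D z = \sum_x D x.1 x.2 * P x z by rewrite /X pair_bigA.
have -> : tensor_dot A B = \sum_x \sum_y
    A x.1 x.2 * (B y.1 y.2)^* * \sum_z P x z * (P y z)^*.
  rewrite /tensor_dot pair_bigA; apply: eq_bigr => x _ /=.
  rewrite pair_bigA; apply: eq_bigr => y _ /=; congr (_ * _).
  rewrite [p _ _]parseval [q _ _]parseval big_distrlr pair_bigA.
  by apply: eq_bigr => z _; rewrite /P rmorphM /= mulrACA.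
under eq_bigr => x _ do (under eq_bigr => y _ do rewrite mulr_sumr;
  rewrite exchange_big).
rewrite exchange_big; apply: eq_bigr => z _ /=.
rewrite !XE rmorph_sum big_distrlr; apply: eq_bigr => x _ /=.
by apply: eq_bigr => y _; rewrite mulrACA -rmorphM.
Qed.

Fact tensor_dot_hermitian A B :
  tensor_dot A B = (-1) ^+ false * (tensor_dot B A)^*.
Proof.
rewrite expr0 mul1r !tensor_dotX rmorph_sum; apply: eq_bigr => z _ /=.
by rewrite rmorphM /= conjCK mulrC.
Qed.
HB.instance Definition _ := isHermitianSesquilinear.Build C (tensor U V)
  false conjC tensor_dot tensor_dot_hermitian.

Fact tensor_dot_gt0 A : A != 0 -> 0 < tensor_dot A A.
Proof.
have freeb (W : vectType C) (a : 'I_(\dim {:W}) -> C) :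
    \sum_i a i *: bas i = 0 -> forall i, a i = 0.
  by move/freeP: (basis_free (vbasisP {:W})) => h E; apply: h; exact: E.
move=> A0; have X0 z : 0 <= X A z * (X A z)^* by exact: mul_conjC_ge0.
rewrite tensor_dotX lt0r sumr_ge0 // andbT; apply: contra A0 => /eqP E.
have {}E r s : X A (r, s) = 0.
  by apply/eqP; rewrite -mul_conjC_eq0; apply/eqP; apply: (psumr_eq0P _ E).
have E1 i (s : 'I_(\dim {:V})) : \sum_j A i j * q (bas j) (onb q)`_s = 0.
  move: i; apply: freeb; apply: (@onb_eq0 _ p) => r.
  rewrite linear_sumlz -[RHS](E r s); apply: eq_bigr => i _.
  rewrite linearZl_LR /= mulr_suml; apply: eq_bigr => j _.
  by rewrite -mulrA [q _ _ * _]mulrC.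
apply/eqP/matrixP=> i j; rewrite mxE; move: j; apply: freeb.
apply: (@onb_eq0 _ q) => s; rewrite linear_sumlz -[RHS](E1 i s).
by apply: eq_bigr => j _; rewrite linearZl_LR.
Qed.
HB.instance Definition _ := isDotProduct.Build C (tensor U V) tensor_dot
  tensor_dot_gt0.

Lemma tensor_dotE u v u' v' :
  tensor_dot (pure u v) (pure u' v') = p u u' * q v v'.
Proof.
have sesq (W : vectType C) (f : {dot W for conjC}) x y : f x y =
    \sum_i \sum_k coord (vbasis {:W}) i x * (coord (vbasis {:W}) k y)^* *
      f (bas i) (bas k).
  rewrite {1}(basE x) linear_sumlz; apply: eq_bigr => i _.
  rewrite linearZl_LR {1}(basE y) linear_sumr mulr_sumr.
  by apply: eq_bigr => k _; rewrite linearZr_LR /= mulrA.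
rewrite [p u u']sesq [q v v']sesq mulr_suml; apply: eq_bigr => i _.
rewrite big_distrlr exchange_big /=; apply: eq_bigr => j _.
apply: eq_bigr => k _; rewrite mulr_sumr; apply: eq_bigr => l _.
by rewrite !mxE rmorphM /= [RHS]mulrACA; congr (_ * _); rewrite mulrACA.
Qed.

End TensorDot.

Lemma tensor_assoc_isometry (U V W : vectType C) (p : {dot U for conjC})
    (q : {dot V for conjC}) (r : {dot W for conjC}) :
  isometry (tensor_dot p (tensor_dot q r)) (tensor_dot (tensor_dot p q) r)
    (tensor_assoc U V W).
Proof.
pose P A B := tensor_dot p (tensor_dot q r) (tensor_assoc U V W A)
  (tensor_assoc U V W B) = tensor_dot (tensor_dot p q) r A B.
have pure0 (X Y : vectType C) (y : Y) : pure (0 : X) y = 0 by exact: linear0l.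
have pureDl (X Y : vectType C) (y : Y) (x x' : X) : pure (x + x') y = pure x y + pure x' y.
  exact: linearDl.
move=> A B; rewrite -/(P A B).
have PDl A1 A2 B' : P A1 B' -> P A2 B' -> P (A1 + A2) B'.
  by rewrite /P linearD /= !linearDl /= => -> ->.
have PDr A' B1 B2 : P A' B1 -> P A' B2 -> P A' (B1 + B2).
  by rewrite /P linearD /= !linearDr /= => -> ->.
have P0l B' : P 0 B' by rewrite /P linear0 !linear0l.
have P0r A' : P A' 0 by rewrite /P linear0 !linear0r.
elim/tensor_ind: A => [|A1 A2|t w]; [exact: P0l | exact: PDl |].
elim/tensor_ind: t => [|t1 t2|u v]; first by rewrite pure0.
  by rewrite pureDl; apply: PDl.
elim/tensor_ind: B => [|B1 B2|t' w']; [exact: P0r | exact: PDr |].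
elim/tensor_ind: t' => [|t1 t2|u' v']; first by rewrite pure0.
  by rewrite pureDl; apply: PDr.
by rewrite /P !tensor_assocE !tensor_dotE /= !tensor_dotE mulrA.
Qed.

Section Adjoint.
Variables (U V : vectType C) (p : {dot U for conjC}) (q : {dot V for conjC}).
Variable f : 'Hom(U, V).

(* The Hilbert adjoint, characterized by adjointP. *)
Definition adjoint : 'Hom(V, U) :=
  linfun (fun v => \sum_(i < \dim {:U}) q v (f (onb p)`_i) *: (onb p)`_i).

Lemma adjointP u v : p u (adjoint v) = q (f u) v.
Proof.
have L : linear
    (fun v => \sum_(i < \dim {:U}) q v (f (onb p)`_i) *: (onb p)`_i).
  move=> a x y; rewrite scaler_sumr -big_split; apply: eq_bigr => i _ /=.
  by rewrite linearPl scalerDl scalerA.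
pose g : {linear V -> U} := HB.pack
  (fun v => \sum_(i < \dim {:U}) q v (f (onb p)`_i) *: (onb p)`_i)
  (GRing.isLinear.Build _ _ _ _ _ L).
rewrite /adjoint (lfunE g) /= linear_sumr.
rewrite [in RHS](onbE p u) linear_sum linear_sumlz; apply: eq_bigr => i _.
by rewrite linearZr_LR linearZ linearZl_LR /= [q _ v]hermC /= expr0 mul1r mulrC.
Qed.

End Adjoint.

End Hilbert.

Section HilbertianFrobenius.
Variables (C : numClosedFieldType) (H : vectType C).
Implicit Types (mu : 'Hom(tensor H H, H)) (I J : {vspace H}).

Definition mul mu (x y : H) : H := mu (pure x y).

Definition hilbertian_semigroup mu := associative (mul mu) /\ commutative (mul mu).

Definition frobenius (dotH : {dot H for conjC}) mu :=
  let mud := adjoint (tensor_dot dotH dotH) dotH mu in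
  let alpha := tensor_assoc H H H in
  (tensor_map mu \1 \o alpha^-1 \o tensor_map \1 mud = mud \o mu)%VF /\
  (mud \o mu = tensor_map \1 mu \o alpha \o tensor_map mud \1)%VF.

Definition hilbertian_frobenius_semigroup (dotH : {dot H for conjC}) mu :=
  hilbertian_semigroup mu /\ frobenius dotH mu.

Definition is_unit mu (e : H) := forall u, mul mu e u = u.

(* Subspaces are {vspace H}: every linear subspace of H is of this form. *)
Definition is_ideal mu I := forall x y, y \in I -> mul mu x y \in I.

Definition modular mu I := exists e, forall x, x - mul mu e x \in I.

(* When there is no such I, the radical below is the whole of H. *)
Definition maximal_modular_ideal mu I :=
  [/\ is_ideal mu I, modular mu I, I != fullv &
      forall J, is_ideal mu J -> J != fullv -> (I <= J)%VS -> J = I].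

Definition in_jacobson_radical mu (x : H) :=
  forall I, maximal_modular_ideal mu I -> x \in I.

Definition semisimple mu := forall x, in_jacobson_radical mu x -> x = 0.

End HilbertianFrobenius.

(* Main.v *)
Require Import Defs.
From HB Require Import structures.
From mathcomp Require Import all_boot all_order all_algebra.
From mathcomp Require Import boolp reals complex.

(** Write [xy] for the product and [L_x] for the operator [y |-> xy].  Tested
    against pure tensors, the Frobenius identity says that the adjoint of
    [L_x] is a module map: [L_x^* (ab) = (L_x^* a) b] ([adjoint_lmulM]).  Hence
    [L_x^*] commutes with every [L_y]; in particular [L_x] is normal, so [L_x]
    and [L_x^*] have the same kernel, and [H] is the orthogonal sum of the
    ideals [xH] and [ker L_x].

    All four assertions are related to the annihilator [Ann = {x | xH = 0}].
    - If [mu^*] is injective then [Ann = 0]: by normality an element of [Ann] is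
      killed by every [L_y^*], so it is orthogonal to all products.
    - If [H] is semisimple then [Ann = 0], because an annihilator lies in every
      modular ideal.
    - If [Ann = 0], decompose [x = xw + b] along [xH + ker L_x].  Each [by] is
      in both summands, so [b] is in [Ann] and [x = xw] ([ann0_local_unit]).
      Local units are merged by [e + f - ef], which gives a global unit
      ([ann0_unit]).  Decomposing [w] in the same way gives [x = x(xv)]
      ([ann0_regular]).  For [x != 0] the element [f = xv] is then a nonzero
      idempotent, [ker L_f] is a proper modular ideal, and a maximal ideal above
      it cannot contain [x]: so the radical is zero ([ann0_semisimple]).

    That a unit makes [mu] onto, and that [mu] onto makes [mu^*] injective, is
    immediate. *)

Set Implicit Arguments.
Unset Strict Implicit.
Unset Printing Implicit Defensive.

Import Order.TTheory GRing.Theory Num.Theory Num.Def.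
Local Open Scope ring_scope.

Section MulBilinear.
Variables (C : numClosedFieldType) (H : vectType C) (mu : 'Hom(tensor H H, H)).

Fact mul_is_bilinear : bilinear_for *:%R *:%R (Defs.mul mu).
Proof.
have [Pl Pr] := pure_is_bilinear H H.
by split=> x a u v; rewrite /Defs.mul /= ?Pl ?Pr linearP.
Qed.
HB.instance Definition _ :=
  bilinear_isBilinear.Build C H H H *:%R *:%R (Defs.mul mu) mul_is_bilinear.
HB.instance Definition _ x :=
  GRing.isLinear.Build C H H *:%R (Defs.mul mu x) (mul_is_bilinear.2 x).

End MulBilinear.

Section Frobenius.
Variables (C : numClosedFieldType) (H : vectType C).
Variables (p : {dot H for conjC}) (mu : 'Hom(tensor H H, H)).

Local Notation "x ** y" := (Defs.mul mu x y) (at level 40, left associativity).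

Definition lmul x : 'Hom(H, H) := linfun (Defs.mul mu x).

Lemma lmulE x y : lmul x y = x ** y.
Proof. by rewrite lfunE. Qed.

Lemma dot_eq0_sym u v : p u v = 0 -> p v u = 0.
Proof. by move=> uv0; rewrite hermC /= uv0 rmorph0 mulr0. Qed.

(** The outer composite of the Frobenius identity, at [x (x) y], applies this
    with [t := mu^* y]. *)
Lemma tensor_map_mul_assoc x (t : tensor H H) :
  tensor_map mu \1 (((tensor_assoc H H H)^-1)%VF (pure x t))
    = tensor_map (lmul x) \1 t.
Proof.
elim/tensor_ind: t => [|A B hA hB|u v].
- by rewrite linear0r !linear0.
- by rewrite linearDr !linearD /= hA hB.
by rewrite tensor_assoc_invE !tensor_mapE lmulE.
Qed.

Lemma tensor_dot_map (f : 'Hom(H, H)) a b t :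
  tensor_dot p p (pure a b) (tensor_map f \1 t)
    = tensor_dot p p (pure (adjoint p p f a) b) t.
Proof.
elim/tensor_ind: t => [|A B hA hB|u v].
- by rewrite linear0 !linear0r.
- by rewrite linearD !linearDr /= hA hB.
rewrite tensor_mapE !tensor_dotE id_lfunE /=; congr (_ * _).
by rewrite [LHS]hermC [RHS]hermC /= adjointP.
Qed.

Hypothesis muHF : hilbertian_frobenius_semigroup p mu.

Let mulA : associative (Defs.mul mu). Proof. by case: muHF => -[]. Qed.
Let mulC : commutative (Defs.mul mu). Proof. by case: muHF => -[]. Qed.

(** This is the adjoint of the Frobenius identity
    [mu^* (xy) = (L_x (x) id) (mu^* y)], obtained by pairing it with
    [a (x) b]. *)
Lemma adjoint_lmulM x a b :
  adjoint p p (lmul x) (a ** b) = adjoint p p (lmul x) a ** b.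
Proof.
have [_ [F _]] := muHF.
have E y : p (a ** b) (x ** y) = p (adjoint p p (lmul x) a ** b) y.
  have /= := congr1 (fun f => tensor_dot p p (pure a b) (fun_of_lfun f (pure x y))) F.
  rewrite !comp_lfunE tensor_mapE id_lfunE tensor_map_mul_assoc tensor_dot_map.
  by rewrite !adjointP.
have {}E y : p (adjoint p p (lmul x) (a ** b) - adjoint p p (lmul x) a ** b) y = 0.
  rewrite linearBl /= -E [X in X - _]hermC /= adjointP lmulE.
  by rewrite [X in _ - X]hermC subrr.
by apply/eqP; rewrite -subr_eq0 -(dnorm_eq0 p) E.
Qed.

Lemma adjoint_lmul_comm x y z :
  adjoint p p (lmul x) (y ** z) = y ** adjoint p p (lmul x) z.
Proof. by rewrite mulC adjoint_lmulM mulC. Qed.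

(** [L_x^*] commutes with [L_x], so
    [<L_x^* z, L_x^* z> = <L_x L_x^* z, z> = <L_x^* L_x z, z>]. *)
Lemma adjoint_lmul_eq0 x z : x ** z = 0 -> adjoint p p (lmul x) z = 0.
Proof.
move=> xz0; apply/eqP; rewrite -(dnorm_eq0 p) adjointP lmulE.
by rewrite -adjoint_lmul_comm xz0 linear0 linear0l.
Qed.

Lemma mul_eq0_adjoint x z : adjoint p p (lmul x) z = 0 -> x ** z = 0.
Proof.
move=> xz0; apply/eqP; rewrite -(dnorm_eq0 p) -[X in p X _]lmulE -(adjointP p).
by rewrite adjoint_lmul_comm xz0 linear0r linear0r.
Qed.

(** [xH] meets [ker L_x] trivially: a vector [xu] killed by [L_x] is killed by
    [L_x^*], hence orthogonal to [xH]. *)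
Lemma mul_cap_ann x u : x ** (x ** u) = 0 -> x ** u = 0.
Proof.
move=> /adjoint_lmul_eq0 h; apply/eqP; rewrite -(dnorm_eq0 p).
by rewrite -[X in p X _]lmulE -(adjointP p) h linear0r.
Qed.

(** The orthogonal complement of [xH] is [ker L_x^*], which equals
    [ker L_x]. *)
Lemma mul_ann_split x z : exists w b, z = x ** w + b /\ x ** b = 0.
Proof.
have [a] := orthogonal_split p (vbasis (limg (lmul x))) z.
rewrite (span_basis (vbasisP _)) => /memv_imgP[w _ ->] [b [zE _ ob]].
exists w, b; rewrite -lmulE; split=> //; apply: mul_eq0_adjoint.
apply/eqP; rewrite -(dnorm_eq0 p) adjointP; apply/eqP.
set y := lmul x _; apply: dot_eq0_sym.
have : y \in limg (lmul x) by rewrite memv_img ?memvf.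
move/coord_vbasis->; rewrite linear_sumr big1 // => i _.
by rewrite linearZr_LR /= (orthoPl ob) ?mulr0 ?mem_nth ?size_tuple.
Qed.

Definition ann0 := forall x, (forall y, x ** y = 0) -> x = 0.

(** An annihilator is in the kernel of every [L_y], hence of every [L_y^*], so
    it is orthogonal to all products and [mu^*] sends it to zero. *)
Lemma adjoint_inj_ann0 : injective (adjoint (tensor_dot p p) p mu) -> ann0.
Proof.
move=> inj x x0; apply: inj; rewrite linear0.
set t := adjoint _ _ _ _; apply/eqP; rewrite -(dnorm_eq0 (tensor_dot p p)).
rewrite {2}/t adjointP; elim/tensor_ind: t => [|A B hA hB|u v].
- by rewrite linear0 linear0l.
- rewrite linearD linearDl /=.
  by rewrite (eqP hA) (eqP hB) addr0.
rewrite -/(u ** v) -lmulE -(adjointP p) adjoint_lmul_eq0 ?linear0r //.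
by rewrite mulC x0.
Qed.

(** An annihilator [x] equals [x - ex], which lies in any ideal modular
    with respect to [e]. *)
Lemma semisimple_ann0 : semisimple mu -> ann0.
Proof.
move=> ss x x0; apply: ss => I [_ [e /(_ x)]].
by rewrite mulC x0 subr0.
Qed.

(** If [x = xw + b] with [xb = 0], then [by = xy - xwy] lies in [xH] and in
    [ker L_x] for every [y], so [b] is an annihilator. *)
Lemma ann0_local_unit x : ann0 -> exists w, x ** w = x.
Proof.
move=> A0; have [w [b [xE xb0]]] := mul_ann_split x x.
suff b0 : b = 0 by exists w; rewrite [RHS]xE b0 addr0.
apply: A0 => y.
have byE : b ** y = x ** (y - w ** y).
  by rewrite linearBr /= mulA {1}xE linearDl /= addrC addKr.
by rewrite byE; apply: mul_cap_ann; rewrite -byE mulA xb0 linear0l.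
Qed.

(** von Neumann regularity: split the local unit [w] of [x] along
    [xH + ker L_x]. *)
Lemma ann0_regular x : ann0 -> exists v, x ** (x ** v) = x.
Proof.
move=> /(ann0_local_unit x)[w xw]; have [v [c [wE xc0]]] := mul_ann_split x w.
by exists v; rewrite -[RHS]xw wE linearDr /= xc0 addr0.
Qed.

Lemma ann0_unit : ann0 -> exists e, is_unit mu e.
Proof.
move=> A0.
have [e eP] : exists e, {in vbasis {:H} : seq H, forall u, e ** u = u}.
  elim: (vbasis {:H} : seq H) => [|x s [e eP]]; first by exists 0.
  have [f fx] := ann0_local_unit x A0.
  (* 1 - e' = (1 - e)(1 - f), so e' fixes whatever e or f fixes *)
  exists (e + f - e ** f) => u; rewrite inE linearBl linearDl /=.
  case/predU1P=> [->|us]; last first.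
    by rewrite [e ** f]mulC -mulA eP // addrK.
  by rewrite -mulA [f ** x]mulC fx addrC addrA addNr add0r.
exists e => u; rewrite (coord_vbasis (memvf u)) linear_sumr.
by apply: eq_bigr => i _; rewrite linearZr_LR /= eP ?mem_nth ?size_tuple.
Qed.

(** In finite dimension a proper ideal of largest dimension is maximal. *)
Lemma maximal_ideal_above I : is_ideal mu I -> I != fullv ->
  exists M, [/\ is_ideal mu M, M != fullv, (I <= M)%VS &
    forall J, is_ideal mu J -> J != fullv -> (M <= J)%VS -> J = M].
Proof.
move=> idI pI.
pose P d := `[< exists M, [/\ is_ideal mu M, M != fullv, (I <= M)%VS
                            & \dim M = d] >].
have exP : exists d, P d by exists (\dim I); apply/asboolP; exists I.
have ubP d : P d -> (d <= \dim {:H})%N.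
  by case/asboolP=> M [_ _ _ <-]; rewrite dimvS ?subvf.
case: (ex_maxnP exP ubP) => d /asboolP[M [idM pM IM dM]] maxd.
exists M; split=> // J idJ pJ MJ; apply/esym/eqP; rewrite eqEdim MJ dM.
by apply: maxd; apply/asboolP; exists J; split=> //; apply: subv_trans MJ.
Qed.

(** A nonzero [x = x(xv)] is excluded from a maximal modular ideal above the
    kernel of the idempotent [f = xv]: an ideal containing both [x] and
    [ker L_f] contains [fy] and [y - fy] for every [y]. *)
Lemma ann0_semisimple : ann0 -> semisimple mu.
Proof.
move=> A0 x Jx; have [v xv] := ann0_regular x A0; set f := x ** v in xv.
have ff : f ** f = f by rewrite {1}/f -mulA [v ** f]mulC mulA xv.
apply: contrapT => /eqP x0.
have fKE y : (y \in lker (lmul f)) = (f ** y == 0) by rewrite memv_ker lmulE.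
have idK : is_ideal mu (lker (lmul f)).
  move=> y z; rewrite !fKE => /eqP fz.
  by rewrite mulA [f ** y]mulC -mulA fz linear0r.
have pK : lker (lmul f) != fullv.
  apply: contraNneq x0 => K; have := memvf x; rewrite -K fKE => /eqP fx.
  by rewrite -xv mulC fx.
have [M [idM pM KM maxM]] := maximal_ideal_above idK pK.
have modM y : y - f ** y \in M.
  by apply: (subvP KM); rewrite fKE linearBr /= mulA ff subrr.
have xM : x \in M by apply: Jx; split=> //; exists f.
case/negP: pM; rewrite eqEsubv subvf; apply/subvP=> y _.
rewrite -[y](subrK (f ** y)) rpredD ?modM //.
by rewrite mulC idM // /f mulC idM.
Qed.

End Frobenius.

Theorem corollary35 (R : realType) (H : vectType R[i])
    (dotH : {dot H for Num.conj}) (mu : 'Hom(tensor H H, H)) :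
  hilbertian_frobenius_semigroup dotH mu ->
  [<-> exists e : H, is_unit mu e;
       forall v : H, exists t : tensor H H, mu t = v;
       injective (adjoint (tensor_dot dotH dotH) dotH mu);
       semisimple mu].
Proof.
move=> muHF; tfae.
- by move=> [e eP] v; exists (pure e v); apply: eP.
- move=> onto u v uv; apply/eqP; rewrite -subr_eq0 -(dnorm_eq0 dotH).
  have [t tE] := onto (u - v); rewrite -{1}tE -(adjointP (tensor_dot dotH dotH)).
  by rewrite linearB /= uv subrr linear0r.
- by move=> /(adjoint_inj_ann0 muHF)/(ann0_semisimple muHF).
- by move=> /(semisimple_ann0 muHF)/(ann0_unit muHF).
Qed.
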